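(* Let $X,Y$ be Banach spaces, $F:X\rightrightarrows Y$ a set-valued mapping, $f:X\to Y$ a function, $S:=\{x\in X\mid 0\in f(x)+F(x)\}$, and $\bar x\in S$. Suppose $\mathrm{gph}\,F$ is closed, $f$ is continuously Fréchet differentiable near $\bar x$, the derivative mapping $\nabla f$ is Lipschitz continuous at $\bar x$, and $F+f$ is metrically regular at $(\bar x,0)$. Then there exists a $\delta>0$ such that for any $x^\star\in S\cap B_{\delta/2}(\bar x)$ and $u\in B_\delta(\bar x)$, there exists a Newton sequence $\{x_k\}_{k\in\mathbb N}$ in $B_\delta(\bar x)$ with $x_0:=u$ converging quadratically to $x^\star$.
   Context: For a set-valued mapping $F:X\rightrightarrows Y$: $\mathrm{gph}\,F=\{(x,y)\mid y\in F(x)\}$, $F^{-1}(y)=\{x\in X\mid y\in F(x)\}$, and $(F+f)(x)=\{y+f(x)\mid y\in F(x)\}$. $B_r(x)$ is the open ball of centre $x$ and radius $r$. $d(x,A)=\inf_{a\in A}d(x,a)$, with $d(x,\emptyset)=+\infty$. $\mathbb N$ is the set of nonnegative integers. A mapping $G:X\rightrightarrows Y$ is metrically regular at $(\bar x,\bar y)\in\mathrm{gph}\,G$ if there exist $\tau>0$ and $\delta>0$ such that $\tau\,d(x,G^{-1}(y))\le d(y,G(x))$ for all $x\in B_\delta(\bar x)$ and $y\in B_\delta(\bar y)$. ''$\nabla f$ is Lipschitz continuous at $\bar x$'' means that there exist $\lambda>0$ and $\delta>0$ such that $\|\nabla f(x)-\nabla f(x')\|\le\lambda\|x-x'\|$ for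 all $x,x'\in B_\delta(\bar x)$. A Newton sequence is a sequence $\{x_k\}_{k\in\mathbb N}$ in $X$ satisfying $0\in f(x_k)+\nabla f(x_k)(x_{k+1}-x_k)+F(x_{k+1})$ for $k=0,1,2,\ldots$. A sequence $\{x_k\}_{k\in\mathbb N}$ converging to a point $x^\star$ converges quadratically to $x^\star$ if there exist $\gamma>0$ and $k_0\in\mathbb N$ such that $\|x_{k+1}-x^\star\|\le\gamma\|x_k-x^\star\|^2$ for all $k\ge k_0$. *)

(* Defs.v *)
(* Real Banach spaces are MathComp-Analysis' completeNormedModType over a
   realType; a set-valued mapping X ⇉ Y is a function X -> set Y. *)
From HB Require Import structures.
From mathcomp Require Import all_boot all_order all_algebra.
From mathcomp Require Import all_classical all_reals all_analysis.

Set Implicit Arguments.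
Unset Strict Implicit.
Unset Printing Implicit Defensive.

Import Order.TTheory GRing.Theory Num.Theory.
Import numFieldNormedType.Exports.

Local Open Scope classical_set_scope.
Local Open Scope ring_scope.

Section SetValuedMappings.
Context {R : realType} {X Y : normedModType R}.

Definition gph (F : X -> set Y) : set (X * Y) := [set p | F p.1 p.2].

Definition sv_inv (F : X -> set Y) (y : Y) : set X := [set x | F x y].

Definition sv_add (F : X -> set Y) (f : X -> Y) (x : X) : set Y :=
  [set y + f x | y in F x].

(* edist_inf A x is d(x, A) in the extended reals, with d(x, set0) = +oo. *)
Definition metrically_regular (G : X -> set Y) (xbar : X) (ybar : Y) : Prop :=
  gph G (xbar, ybar) /\
  exists tau delta : R, [/\ 0 < tau, 0 < delta &
    forall (x : X) (y : Y), ball xbar delta x -> ball ybar delta y ->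
      (tau%:E * edist_inf (sv_inv G y) x <= edist_inf (G x) y)%E].

Definition solution_set (F : X -> set Y) (f : X -> Y) : set X :=
  [set x | sv_add F f x 0].

End SetValuedMappings.

Section Derivatives.
Context {R : realType} {X Y : normedModType R}.

(* The operator norm of a linear map. It is taken in the extended reals so
   that an unbounded map gets norm +oo, whereas a real-valued sup would
   give it norm 0. *)
Definition opnorm (A : X -> Y) : \bar R :=
  ereal_sup [set (`|A v|)%:E | v in [set v : X | `|v| <= 1]].

Definition deriv_dist (f : X -> Y) (x x' : X) : \bar R :=
  opnorm (fun v => 'd f x v - 'd f x' v).

Definition continuously_differentiable_near (f : X -> Y) (xbar : X) : Prop :=
  \forall x \near xbar, differentiable f x /\
    deriv_dist f x' x @[x' --> x] --> 0%E.

Definition derivative_lipschitz_at (f : X -> Y) (xbar : X) : Prop :=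
  exists lambda delta : R, [/\ 0 < lambda, 0 < delta &
    forall x x' : X, ball xbar delta x -> ball xbar delta x' ->
      (deriv_dist f x x' <= (lambda * `|x - x'|)%:E)%E].

(* 'd f is total, with an arbitrary value where f is not differentiable: the
   first conjunct makes the derivative in the second one the genuine one. *)
Definition newton_sequence (F : X -> set Y) (f : X -> Y) (x : nat -> X) : Prop :=
  forall k : nat, differentiable f (x k) /\
    sv_add F (fun z => f (x k) + 'd f (x k) (z - x k)) (x k.+1) 0.

End Derivatives.

Definition converges_quadratically {R : realType} {X : normedModType R}
    (x : nat -> X) (xstar : X) : Prop :=
  x @ \oo --> xstar /\
  exists gamma : R, 0 < gamma /\ exists k0 : nat, forall k : nat, (k0 <= k)%N ->
    `|x k.+1 - xstar| <= gamma * `|x k - xstar| ^+ 2.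

(* Main.v *)
(* One Newton step from u towards a solution x* is itself found by iteration.
   With h z := f z - f u - f'(u) (z - u), the linearized inclusion
   0 \in f u + f'(u) (z - u) + F z reads h z \in (F + f) z. Starting at x*,
   metric regularity yields z_(n+1) with h z_n \in (F + f) z_(n+1) and
   |z_(n+1) - z_n| <= (2/tau) |h z_n - h z_(n-1)|. Near xbar the map h has
   Lipschitz constant at most 2 lambda delta, so the steps decrease
   geometrically, and the limit solves the inclusion because gph F is closed.
   Since |h x*| <= lambda |u - x*|^2, that solution lies within
   (4 lambda/tau) |u - x*|^2 of x*. *)
Require Import Defs.
From HB Require Import structures.
From mathcomp Require Import all_boot all_order all_algebra.
From mathcomp Require Import all_classical all_reals all_analysis.
From mathcomp Require Import ring lra.
Set Implicit Arguments.
Unset Strict Implicit.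
Unset Printing Implicit Defensive.
Import Order.TTheory GRing.Theory Num.Theory.
Import numFieldNormedType.Exports.
Local Open Scope classical_set_scope.
Local Open Scope ring_scope.

(** * Mean value inequality on segments *)

(* The supremum of the set of t at which the increment bound holds is 1: the
   bound persists at the supremum and slightly beyond it. *)
Lemma increment_le (R : realType) (Y : normedModType R) (phi : R -> Y) (K : R) :
  (forall t : R, 0 <= t <= 1 ->
    \forall s \near t, `|phi s - phi t| <= K * `|s - t|) ->
  `|phi 1 - phi 0| <= K.
Proof.
move=> phiK.
pose A : set R := [set t | 0 <= t <= 1 /\ `|phi t - phi 0| <= K * t].
have A0 : A 0 by split; rewrite ?lexx ?ler01// subrr normr0 mulr0.
have supA : has_sup A by split; [exists 0 | exists 1 => t [/andP[]]].
have c01 : 0 <= sup A <= 1.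
  apply/andP; split; first exact: sup_upper_bound.
  by apply: ge_sup; [exists 0 | move=> t [/andP[]]].
have [e /= e0 He] := phiK _ c01.
have stepA t : A t -> `|phi (sup A) - phi t| <= K * `|sup A - t| -> A (sup A).
  move=> At h; split=> //; have tc := sup_upper_bound supA At.
  rewrite ger0_norm ?subr_ge0// in h.
  have := ler_normD (phi (sup A) - phi t) (phi t - phi 0).
  rewrite addrA subrK => /le_trans; apply.
  by case: At => _ At; lra.
have Ac : A (sup A).
  have [t At ct] := sup_adherent e0 supA.
  apply: (stepA t At); rewrite distrC (distrC (sup A)); apply: He => /=.
  have tc := sup_upper_bound supA At.
  by rewrite ger0_norm ?subr_ge0//; lra.
have [c1|c1] := ltP (sup A) 1; last first.
  have c1' : sup A = 1 by apply/eqP; rewrite eq_le c1; case/andP: c01 => _ ->.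
  by case: Ac => _; rewrite c1' mulr1.
pose t := Num.min 1 (sup A + e / 2).
have ct : sup A < t by rewrite lt_min c1/=; lra.
suff /(sup_upper_bound supA) : A t by rewrite leNgt ct.
have t1 : t <= 1 by rewrite ge_min lexx.
have te : t <= sup A + e / 2 by rewrite ge_min lexx orbT.
split; first by rewrite t1 andbT; lra.
have : `|phi t - phi (sup A)| <= K * `|t - sup A|.
  by apply: He; rewrite /= distrC ger0_norm ?subr_ge0 ?(ltW ct)//; lra.
rewrite ger0_norm ?subr_ge0 ?(ltW ct)// => h.
have := ler_normD (phi t - phi (sup A)) (phi (sup A) - phi 0).
rewrite addrA subrK => /le_trans; apply.
by case: Ac => _ Ac; lra.
Qed.

(** Differentiability bounds increments only up to an arbitrarily small slack [e]. Taking the slack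
    [e / |b - a|] in [increment_le] along the segment costs [e] in total, and [e] is arbitrary. *)
Lemma segment_lipschitz (R : realType) (X Y : normedModType R) (h : X -> Y)
    (a b : X) (M : R) :
  (forall t e : R, 0 <= t <= 1 -> 0 < e ->
    \forall x \near a + t *: (b - a),
      `|h x - h (a + t *: (b - a))| <= (M + e) * `|x - (a + t *: (b - a))|) ->
  `|h b - h a| <= M * `|b - a|.
Proof.
move=> hM; have [->|ab] := eqVneq b a; first by rewrite !subrr !normr0 mulr0.
have n0 : 0 < `|b - a| by rewrite normr_gt0 subr_eq0.
apply/ler_addgt0Pr => e e0.
pose phi t := h (a + t *: (b - a)).
have -> : h b - h a = phi 1 - phi 0 by rewrite /phi scale1r scale0r addr0 subrKC.
apply: increment_le => t t01.
have := hM t _ t01 (divr_gt0 e0 n0).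
have cont : (fun s => a + s *: (b - a)) @ t --> a + t *: (b - a).
  apply: cvgD; first exact: cvg_cst.
  exact: (@cvgZr_tmp _ _ _ _ _ id _ _ cvg_id).
move=> /cont ht; apply: (@filterS _ (nbhs t) _ _ _ _ ht) => s /= /le_trans; apply.
rewrite opprD addrACA subrr add0r -scalerBl normrZ.
rewrite le_eqVlt; apply/orP; left; apply/eqP; field.
by rewrite gt_eqF.
Qed.

Lemma diff_remainder (R : realType) (X Y : normedModType R) (f : X -> Y)
    (c : X) (e : R) :
  differentiable f c -> 0 < e ->
  \forall x \near c, `|f x - f c - 'd f c (x - c)| <= e * `|x - c|.
Proof.
move=> /diff_locallyP[_ /eqaddoP/(_ e) +] e0 => /(_ e0).
rewrite (near_shift 0 c) subr0; apply: filterS => v /=.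
by rewrite !fctE /= addrK opprD addrA.
Qed.

Lemma segment_norm_le (R : realType) (X : normedModType R) (a b p : X) (t r : R) :
  0 <= t <= 1 -> `|a - p| <= r -> `|b - p| <= r ->
  `|a + t *: (b - a) - p| <= r.
Proof.
move=> /andP[t0 t1] ar br.
have -> : a + t *: (b - a) - p = (1 - t) *: (a - p) + t *: (b - p).
  by rewrite scalerBl scale1r -[RHS]addrA [- _ + _]addrC -scalerBr opprB addrA subrK addrAC.
apply: (le_trans (ler_normD _ _)); rewrite !normrZ ger0_norm ?subr_ge0// ger0_norm//.
nra.
Qed.

(** * Operator norm and linearization error *)

Lemma opnorm_le (R : realType) (X Y : normedModType R) (A : {linear X -> Y}) (C : R) (v : X) :
  (opnorm A <= C%:E)%E -> `|A v| <= C * `|v|.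
Proof.
move=> AC; have [->|v0] := eqVneq v 0; first by rewrite linear0 !normr0 mulr0.
have n0 : 0 < `|v| by rewrite normr_gt0.
have : (`|A (`|v|^-1 *: v)|%:E <= C%:E)%E.
  apply: le_trans AC; apply: ereal_sup_ubound; exists (`|v|^-1 *: v) => //=.
  by rewrite normrZ ger0_norm ?invr_ge0// mulVf ?gt_eqF.
by rewrite lee_fin linearZ normrZ ger0_norm ?invr_ge0// mulrC ler_pdivrMr.
Qed.

(** Turns a linearization remainder into an increment of the single function [f - L], to which the
    mean value inequality applies. *)
Lemma sub_linearE (R : realType) (X Y : normedModType R) (f : X -> Y)
    (L : {linear X -> Y}) (x y : X) :
  f x - f y - L (x - y) = (f x - L x) - (f y - L y).
Proof. by rewrite linearB !opprB addrACA [RHS]addrACA [- f y - _]addrC. Qed.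

(** The function [f - 'd f u] has derivative ['d f c - 'd f u] at a point [c] of the segment, of
    norm at most [lambda * |c - u| <= lambda * rho]. *)
Lemma linearization_error (R : realType) (X Y : normedModType R) (f : X -> Y)
    (p u a b : X) (lambda r rho : R) :
  0 <= lambda ->
  (forall x, ball p r x -> differentiable f x) ->
  (forall x x', ball p r x -> ball p r x' ->
    (deriv_dist f x x' <= (lambda * `|x - x'|)%:E)%E) ->
  ball p r u -> ball p r a -> ball p r b ->
  `|a - u| <= rho -> `|b - u| <= rho ->
  `|f b - f a - 'd f u (b - a)| <= lambda * rho * `|b - a|.
Proof.
move=> l0 df lip pu pa pb au bu.
pose h x := f x - 'd f u x.
have hB x y : f x - f y - 'd f u (x - y) = h x - h y by exact: sub_linearE.
rewrite hB.
apply: segment_lipschitz => t e t01 e0.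
set c := a + t *: (b - a).
have pc : ball p r c.
  move: pa pb; rewrite -!ball_normE /= ![`|p - _|]distrC => pa pb.
  apply: (@le_lt_trans _ _ (Num.max `|a - p| `|b - p|)); last by rewrite gt_max pa pb.
  by apply: segment_norm_le; rewrite // le_max lexx ?orbT.
apply: filterS (diff_remainder (df _ pc) e0) => x hx.
have -> : h x - h c = (f x - f c - 'd f c (x - c)) + ('d f c (x - c) - 'd f u (x - c)).
  by rewrite addrA subrK hB.
apply: (le_trans (ler_normD _ _)); rewrite mulrDl addrC lerD//.
have dl : linear (fun v => 'd f c v - 'd f u v).
  by move=> k v w; rewrite ['d f c _]linearP ['d f u _]linearP scalerBr opprD addrACA.
pose L : {linear X -> Y} := HB.pack (fun v => 'd f c v - 'd f u v)
  (GRing.isLinear.Build R X Y _ _ dl).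
have := @opnorm_le _ _ _ L _ (x - c) (lip _ _ pc pu).
move=> /le_trans; apply; apply: ler_wpM2r => //; apply: ler_wpM2l => //.
exact: segment_norm_le.
Qed.

(** * Closedness and metric regularity of [F + f] *)

Lemma sv_addE (R : realType) (X Y : normedModType R) (F : X -> set Y)
    (f : X -> Y) (x : X) (y : Y) : sv_add F f x y = F x (y - f x).
Proof.
apply/propext; split=> [[z Fz <-]|Fy]; first by rewrite addrK.
by exists (y - f x) => //; rewrite subrK.
Qed.

(** The shear [(x, y) |-> (x, y - f x)] carries the graph of [F + f] into that of [F]. The statement
    is pointwise because [f] is known to be continuous only near [xbar]. *)
Lemma sv_add_closure (R : realType) (X Y : normedModType R) (F : X -> set Y)
    (f : X -> Y) (x : X) (y : Y) :
  closed (gph F) -> {for x, continuous f} ->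
  closure (gph (sv_add F f)) (x, y) -> sv_add F f x y.
Proof.
move=> clF fx cl; rewrite sv_addE.
suff /clF : closure (gph F) (x, y - f x) by [].
pose T (p : X * Y) := (p.1, p.2 - f p.1).
have cT : T @ (x, y) --> T (x, y).
  apply: cvg_pair; first exact: cvg_fst.
  apply: cvgB; first exact: cvg_snd.
  by apply: continuous_comp; [exact: cvg_fst | exact: fx].
move=> B /cT/cl[q [Gq Bq]]; exists (T q); split=> //.
by move: Gq; rewrite /gph /= sv_addE.
Qed.

(** The distance to [sv_inv G y] need not be attained; the factor 2 instead of 1 leaves room for an
    actual point. If [y = y'] there is no such room, but [x] itself serves. *)
Lemma metric_regularity_step (R : realType) (X Y : normedModType R)
    (G : X -> set Y) (tau : R) (x : X) (y y' : Y) :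
  0 < tau ->
  (tau%:E * edist_inf (sv_inv G y) x <= edist_inf (G x) y)%E ->
  G x y' ->
  exists x' : X, G x' y /\ `|x' - x| <= 2 / tau * `|y - y'|.
Proof.
move=> tau0 reg Gxy; have [->|yy] := eqVneq y y'.
  by exists x; rewrite !subrr !normr0 mulr0.
have d0 : 0 < `|y - y'| by rewrite normr_gt0 subr_eq0.
set d := `|y - y'| in d0 *.
have le1 : (edist_inf (G x) y <= (3 / 2 * d)%:E)%E.
  apply: (@le_trans _ _ (edist (y, y'))); first by apply: ereal_inf_lbound; exists y'.
  apply: edist_fin; first by rewrite mulr_gt0.
  by rewrite -ball_normE /= -/d; lra.
have : (edist_inf (sv_inv G y) x < (2 / tau * d)%:E)%E.
  rewrite ltNge; apply/negP => le2.
  have := le_trans (lee_wpmul2l _ le2) (le_trans reg le1).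
  rewrite lee_fin ltW// => /(_ isT).
  rewrite -EFinM lee_fin.
  have -> : tau * (2 / tau * d) = 2 * d by field; rewrite gt_eqF.
  by lra.
move=> /ereal_inf_lt[_ [x' Gx' <-]] /edist_lt_ball.
rewrite -ball_normE /= distrC => /ltW xx'; by exists x'.
Qed.

(** * Iterative solution of a perturbed inclusion *)

Lemma cvg_of_geometric_steps (R : realType) (X : completeNormedModType R)
    (z : nat -> X) (a q : R) :
  `|q| < 1 -> (forall n, `|z n.+1 - z n| <= a * q ^+ n) ->
  cvgn z.
Proof.
move=> q1 zq.
have : cvgn (series (telescope z)).
  apply: normed_cvg; apply: (@series_le_cvg _ _ (geometric a q)).
  - by move=> n /=.
  - by move=> n /=; apply: le_trans (zq n).
  - by move=> n; exact: zq.
  - exact: is_cvg_geometric_series.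
move=> /(is_cvgD (is_cvg_cst (z 0%N))).
suff -> : (fun=> z 0%N) + series (telescope z) = z by [].
by apply/funext => n; rewrite [RHS]eq_sum_telescope.
Qed.

Lemma perturbed_inclusion (R : realType) (X : completeNormedModType R)
    (Y : normedModType R) (G : X -> set Y) (h : X -> Y) (x0 : X) (y0 : Y)
    (c rho : R) :
  0 < c -> G x0 y0 -> 2 * c * `|h x0 - y0| <= rho ->
  (forall x y, `|x - x0| <= rho -> G x y ->
    exists x', G x' (h x) /\ `|x' - x| <= c * `|h x - y|) ->
  (forall x x', `|x - x0| <= rho -> `|x' - x0| <= rho ->
    c * `|h x - h x'| <= `|x - x'| / 2) ->
  (forall x y, `|x - x0| <= rho -> closure (gph G) (x, y) -> G x y) ->
  exists z, G z (h z) /\ `|z - x0| <= 2 * c * `|h x0 - y0|.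
Proof.
move=> c0 G0 hrho step lip cl.
(* The hypotheses move under the existential so that [choice] yields a total function; [x0] is a
   default value. *)
have step' (p : X * Y) : exists x', `|p.1 - x0| <= rho -> G p.1 p.2 ->
    G x' (h p.1) /\ `|x' - p.1| <= c * `|h p.1 - p.2|.
  have [H|H] := pselect (`|p.1 - x0| <= rho /\ G p.1 p.2).
    by have [x' ?] := step _ _ H.1 H.2; exists x'.
  by exists x0 => ? ?; case: H.
have [s Hs] := choice step'.
(* The second component lags by one: it is [h] of the previous point, and [y0] at the start. *)
pose p n := iter n (fun p => (s p, h p.1)) (x0, y0).
set d := c * `|h x0 - y0|.
have d0 : 0 <= d by rewrite mulr_ge0// ltW.
have hd : 2 * c * `|h x0 - y0| = 2 * d by rewrite mulrA.
rewrite hd in hrho *.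
have q0 n : 0 <= 2^-1 ^+ n :> R by rewrite exprn_ge0.
(* The middle bound is the geometric sum of the first [n] steps, which keeps the iterates within
   [rho]; the last one bounds the next step. *)
have Hp n : [/\ G (p n).1 (p n).2, `|(p n).1 - x0| <= 2 * d * (1 - 2^-1 ^+ n) &
    c * `|h (p n).1 - (p n).2| <= d * 2^-1 ^+ n].
  elim: n => [|n [Gn xn yn]].
    by rewrite /= subrr normr0 expr0 subrr mulr0 mulr1.
  have rn : `|(p n).1 - x0| <= rho by have := q0 n; nra.
  have [Gs xs] := Hs _ rn Gn.
  have xS : `|s (p n) - x0| <= 2 * d * (1 - 2^-1 ^+ n.+1).
    have := ler_normD (s (p n) - (p n).1) ((p n).1 - x0).
    rewrite addrA subrK exprS => /le_trans; apply; lra.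
  split=> //=.
  apply: (le_trans (lip _ _ _ rn)); first by have := q0 n.+1; nra.
  by rewrite exprS; lra.
have rn n : `|(p n).1 - x0| <= rho by have [_ h1 _] := Hp n; have := q0 n; nra.
pose z n := (p n).1.
have zs n : `|z n.+1 - z n| <= d * 2^-1 ^+ n.
  by have [Gn _ yn] := Hp n; have [_ /le_trans] := Hs _ (rn n) Gn; apply.
have /cvg_ex[l zl] : cvgn z.
  by apply: (cvg_of_geometric_steps _ zs); rewrite ger0_norm; lra.
have ld : `|l - x0| <= 2 * d.
  apply: (@closed_cvg _ _ _ _ z [set x | `|x - x0| <= 2 * d] _ _ _ zl).
    have -> : [set x | `|x - x0| <= 2 * d] = closed_ball_ Num.norm x0 (2 * d).
      by apply/seteqP; split=> x /=; rewrite distrC.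
    exact: closed_closed_ball_.
  by apply: nearW => n /=; have [_ h1 _] := Hp n; have := q0 n; nra.
have lr := le_trans ld hrho.
exists l; split=> //; apply: cl => //.
have hl : h (z n) @[n --> \oo] --> h l.
  apply/cvgrPdist_le => e e0.
  have ce : 0 < 2 * c * e by rewrite !mulr_gt0.
  move/cvgrPdist_le: zl => /(_ _ ce); apply: filterS => n ln.
  have := le_trans (lip _ _ lr (rn n)) (ler_wpM2r _ ln).
  rewrite invr_ge0 ler0n => /(_ isT).
  have -> : 2 * c * e / 2 = c * e by field.
  by rewrite ler_pM2l.
(* The graph points are [(z n.+1, h (z n))], hence the shift. *)
have zl' : z n.+1 @[n --> \oo] --> l by rewrite cvg_shiftS.
move=> B /(cvg_pair zl' hl) Bz; have [n Bn] := @filter_ex nat \oo _ _ Bz.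
by exists (z n.+1, h (z n)); split=> //; have [] := Hp n.+1.
Qed.

(** * Newton step and quadratic convergence *)

(** The bound by [tau] makes the inner iteration contract and stay near [xs]; the bound by 1 keeps
    the values of [h] in the ball where metric regularity holds. *)
Lemma newton_step (R : realType) (X Y : completeNormedModType R)
    (F : X -> set Y) (f : X -> Y) (p xs u : X) (tau lambda r delta : R) :
  0 < tau -> 0 < lambda -> 0 < delta ->
  delta <= r -> 24 * lambda * delta <= tau -> 8 * lambda * delta <= 1 ->
  closed (gph F) ->
  (forall x, ball p r x -> differentiable f x) ->
  (forall x x', ball p r x -> ball p r x' ->
    (deriv_dist f x x' <= (lambda * `|x - x'|)%:E)%E) ->
  (forall x y, ball p r x -> ball (0 : Y) r y ->
    (tau%:E * edist_inf (sv_inv (sv_add F f) y) x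
       <= edist_inf (sv_add F f x) y)%E) ->
  solution_set F f xs -> ball p (delta / 2) xs -> ball p delta u ->
  exists z, sv_add F (fun w => f u + 'd f u (w - u)) z 0 /\
    `|z - xs| <= 4 / tau * lambda * `|u - xs| ^+ 2.
Proof.
move=> tau0 l0 d0 dr dtau d1 clF df lip reg Sxs pxs pu.
have sub x : ball p delta x -> ball p r x by apply: le_ball.
have pxs' : ball p delta xs by apply: le_ball pxs; lra.
set a := `|u - xs|.
have a0 : 0 <= a by exact: normr_ge0.
have diam x x' : ball p delta x -> ball p delta x' -> `|x - x'| <= 2 * delta.
  rewrite -!ball_normE /= => px px'.
  by rewrite (le_trans (ler_distD p _ _))// [`|x - p|]distrC; lra.
have ha : a < 3 / 2 * delta.
  move: pxs pu; rewrite -!ball_normE /= => px px'.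
  by rewrite (le_lt_trans (ler_distD p _ _))// [`|u - p|]distrC; lra.
(* Here [a / 4 < 3/8 delta], so [x] is within [7/8 delta] of [p]. *)
have near_xs x : `|x - xs| <= a / 4 -> ball p delta x.
  move: pxs; rewrite -!ball_normE /= => px h.
  by rewrite (le_lt_trans (ler_distD xs _ _))// [`|xs - x|]distrC; lra.
pose h x := f x - f u - 'd f u (x - u).
have hB x x' : h x - h x' = f x - f x' - 'd f u (x - x').
  have [g gE] : exists g : X -> Y, forall w w',
      f w - f w' - 'd f u (w - w') = g w - g w'.
    by exists (fun w => f w - 'd f u w) => w w'; exact: sub_linearE.
  by rewrite /h !gE opprB addrA subrK.
have hu : h u = 0 by rewrite /h !subrr linear0 subr0.
have errh := linearization_error (ltW l0) df lip (sub _ pu).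
have h_lip x x' : ball p delta x -> ball p delta x' ->
    `|h x - h x'| <= lambda * (2 * delta) * `|x - x'|.
  by move=> px px'; rewrite hB; apply: errh; rewrite ?sub ?diam//; apply: sub.
have h_small x : ball p delta x -> `|h x| < r.
  move=> px; have := h_lip _ _ px pu; rewrite hu subr0 => /le_lt_trans; apply.
  have := diam _ _ px pu; have := normr_ge0 (x - u); nra.
(* As [h u = 0], this is the linearization error between [u] and [xs] with [rho = a]: the source of
   the square. *)
have hxs : `|h xs - 0| <= lambda * a ^+ 2.
  rewrite -hu hB expr2 mulrA /a [`|u - xs|]distrC.
  by apply: errh; rewrite ?subrr ?normr0//; apply: sub.
(* From [a < 3/2 delta] and the constant 24. *)
have lta : lambda * a <= tau / 16 by nra.
have c0 : 0 < 2 / tau by rewrite divr_gt0.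
have bound : 2 * (2 / tau) * `|h xs - 0| <= 4 / tau * lambda * a ^+ 2.
  have -> : 2 * (2 / tau) = 4 / tau by field; rewrite gt_eqF.
  by rewrite -[leRHS]mulrA ler_wpM2l// divr_ge0// ltW.
have rho : 2 * (2 / tau) * `|h xs - 0| <= a / 4.
  apply: (le_trans bound).
  have -> : 4 / tau * lambda * a ^+ 2 = 4 * (lambda * a) * a / tau.
    by field; rewrite gt_eqF.
  by rewrite ler_pdivrMr//; nra.
have [x y /near_xs px Gxy|x x' /near_xs px /near_xs px'|x y /near_xs px|z [Gz zxs]] :=
  perturbed_inclusion (G := sv_add F f) c0 Sxs rho.
- apply: metric_regularity_step => //; apply: reg; first exact: sub.
  by rewrite -ball_normE /= sub0r normrN h_small.
- apply: (le_trans (ler_wpM2l (ltW c0) (h_lip _ _ px px'))).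
  have -> : 2 / tau * (lambda * (2 * delta) * `|x - x'|) =
      4 * lambda * delta / tau * `|x - x'| by field; rewrite gt_eqF.
  rewrite [leRHS]mulrC ler_wpM2r// ler_pdivrMr//; nra.
- apply: sv_add_closure => //.
  exact/differentiable_continuous/df/sub.
exists z; split; last exact: le_trans bound.
(* The term [f z] in [h z] cancels the one added to [F z], leaving the linearized inclusion. *)
move: Gz; rewrite !sv_addE /h sub0r.
suff -> : f z - f u - 'd f u (z - u) - f z = - (f u + 'd f u (z - u)) by [].
by rewrite opprD -[f z - _ - _]addrA addrAC subrr add0r.
Qed.

Theorem theorem5p1 (R : realType) (X Y : completeNormedModType R)
  (F : X -> set Y) (f : X -> Y) (xbar : X)
  (hxbar : solution_set F f xbar)
  (hF : closed (gph F))
  (hf : continuously_differentiable_near f xbar)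
  (hlip : derivative_lipschitz_at f xbar)
  (hreg : metrically_regular (sv_add F f) xbar 0) :
  exists delta : R, 0 < delta /\
    forall xstar u : X,
      solution_set F f xstar -> ball xbar (delta / 2) xstar ->
      ball xbar delta u ->
      exists x : nat -> X,
        [/\ newton_sequence F f x,
            forall k : nat, ball xbar delta (x k),
            x 0%N = u &
            converges_quadratically x xstar].
Proof.
have [r0 /= r00 df0] : nbhs_ball xbar [set x | differentiable f x].
  by apply/nbhs_ballP; apply: filterS hf => x [].
have [lambda [r1 [l0 r10 lip1]]] := hlip.
have [_ [tau [r2 [tau0 r20 reg2]]]] := hreg.
pose r := Num.min r0 (Num.min r1 r2).
have rr0 : r <= r0 by rewrite ge_min lexx.
have rr1 : r <= r1 by rewrite !ge_min lexx orbT.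
have rr2 : r <= r2 by rewrite !ge_min lexx !orbT.
have r_gt0 : 0 < r by rewrite !lt_min r00 r10.
pose delta := Num.min r (Num.min (tau / (24 * lambda)) (8 * lambda)^-1).
have d0 : 0 < delta by rewrite lt_min r_gt0 lt_min divr_gt0 ?invr_gt0 ?mulr_gt0.
have dr : delta <= r by rewrite ge_min lexx.
have dtau : 24 * lambda * delta <= tau.
  by rewrite mulrC -ler_pdivlMr ?mulr_gt0// !ge_min lexx orbT.
have d1 : 8 * lambda * delta <= 1.
  by rewrite mulrC -ler_pdivlMr ?mulr_gt0// div1r !ge_min lexx !orbT.
have df x : ball xbar r x -> differentiable f x.
  by move=> px; apply: df0; apply: le_ball px.
have lip x x' : ball xbar r x -> ball xbar r x' ->
    (deriv_dist f x x' <= (lambda * `|x - x'|)%:E)%E.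
  by move=> px px'; apply: lip1; apply: le_ball rr1 _ _.
have reg x y : ball xbar r x -> ball (0 : Y) r y ->
    (tau%:E * edist_inf (sv_inv (sv_add F f) y) x
       <= edist_inf (sv_add F f x) y)%E.
  by move=> px py; apply: reg2; apply: le_ball rr2 _ _.
exists delta; split=> // xs u Sxs pxs pu.
pose gamma := 4 / tau * lambda.
have g0 : 0 < gamma by rewrite mulr_gt0// divr_gt0.
have step (v : X) : exists z, ball xbar delta v ->
    sv_add F (fun w => f v + 'd f v (w - v)) z 0 /\
    `|z - xs| <= gamma * `|v - xs| ^+ 2.
  have [pv|npv] := pselect (ball xbar delta v); last by exists v.
  have [z Hz] := newton_step tau0 l0 d0 dr dtau d1 hF df lip reg Sxs pxs pv.
  by exists z.
have [N HN] := choice step.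
(* One factor [|v - xs|] of the quadratic bound is at most [3/2 delta], and [gamma * (3/2 delta) = 6
   * lambda * delta / tau <= 1/4]. *)
have contr v : ball xbar delta v -> `|N v - xs| <= `|v - xs| / 4.
  move=> pv; apply: (le_trans (HN _ pv).2).
  have hv : `|v - xs| <= 3 / 2 * delta.
    move: pxs pv; rewrite -!ball_normE /= => px px'.
    by rewrite (le_trans (ler_distD xbar _ _))// [`|v - _|]distrC; lra.
  have gd : gamma * (3 / 2 * delta) <= 4^-1.
    have -> : gamma * (3 / 2 * delta) = 6 * lambda * delta / tau.
      by rewrite /gamma; field; rewrite gt_eqF.
    rewrite ler_pdivrMr//; nra.
  have gv := le_trans (ler_wpM2l (ltW g0) hv) gd.
  by rewrite expr2 mulrA mulrC ler_wpM2l.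
(* The radius [delta / 2] for [xs] enters here: [N v] is within [3/8 delta] of [xs], hence within
   [7/8 delta] of [xbar]. *)
have Nball v : ball xbar delta v -> ball xbar delta (N v).
  move=> pv; have := contr _ pv; move: pxs pv; rewrite -!ball_normE /= => px pv hN.
  have := ler_distD xbar v xs; have := ler_distD xs xbar (N v).
  rewrite [`|xs - N v|]distrC [`|v - xbar|]distrC; lra.
pose x k := iter k N u.
have xball k : ball xbar delta (x k) by elim: k => //= k; exact: Nball.
exists x; split=> //.
  by move=> k; split; [exact/df/(le_ball dr) | exact: (HN _ (xball k)).1].
split; last first.
  by exists gamma; split=> //; exists 0%N => k _; exact: (HN _ (xball k)).2.
(* Convergence comes from the linear rate 1/4; the quadratic estimate alone would not give it. *)
have xgeo k : `|x k - xs| <= `|u - xs| * 4^-1 ^+ k.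
  elim: k => [|k IH]; first by rewrite mulr1.
  by apply: (le_trans (contr _ (xball k))); rewrite exprSr mulrA ler_wpM2r.
apply/cvgrPdist_le => e e0.
have q1 : `|4^-1 : R| < 1 by rewrite ger0_norm; lra.
have /cvgr0_norm_le /(_ _ e0) := cvg_geometric `|u - xs| q1.
apply: filterS => k /= ke; rewrite distrC (le_trans (xgeo k))//.
exact: le_trans (ler_norm _) ke.
Qed.
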